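(* For every graph model $\mathcal{G}$ with web $(G,i)$ there exists a graph model $\mathcal{G}'$ with a countable web $(G',i')$ which is a subpair of $(G,i)$, such that $\mathrm{Th}_{\sqsubseteq}(\mathcal{G}')=\mathrm{Th}_{\sqsubseteq}(\mathcal{G})$, and hence such that $\mathrm{Th}(\mathcal{G}')=\mathrm{Th}(\mathcal{G})$.
   Context: For a set $G$, $G^*$ is the set of finite subsets of $G$. A *partial pair* is $(A,j)$ with $A$ a non-empty set and $j:A^*\times A\to A$ a partial (possibly total) injection. $(A,j_A)$ is a *subpair* of $(B,j_B)$ if $A\subseteq B$ and $j_B(a,\alpha)$ is defined and equal to $j_A(a,\alpha)$ for all $(a,\alpha)\in\mathrm{dom}(j_A)$. A *total pair* is a pair $(G,i)$ with $G$ infinite and $i:G^*\times G\to G$ an injective total function. The *graph model* $\mathcal{G}$ with web $(G,i)$ is the $\lambda$-model carried by the powerset $\mathcal{P}(G)$ ordered by inclusion in which, for $\rho:\mathrm{Var}\to\mathcal{P}(G)$, untyped $\lambda$-terms are interpreted by $|x|_\rho=\rho(x)$, $|MN|_\rho=\{\alpha\in G:\exists a\subseteq|N|_\rho\text{ finite},\ i(a,\alpha)\in|M|_\rho\}$, $|\lambda x.M|_\rho=\{i(a,\alpha):a\in G^*,\ \alpha\in|M|_{\rho[x:=a]}\}$. $\mathrm{Th}_{\sqsubseteq}(\mathcal{G})=\{(M,N):|M|_\rho\subseteq|N|_\rho\ \forall\rho\}$ and $\mathrm{Th}(\mathcal{G})=\{(M,N):|M|_\rho=|N|_\rho\ \forall\rho\}$.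 *)

(* Defs.v *)
From mathcomp Require Import all_boot.
From mathcomp Require Import boolp classical_sets functions cardinality.

Set Implicit Arguments.
Unset Strict Implicit.
Unset Printing Implicit Defensive.

Local Open Scope classical_set_scope.

(* A^* : the finite subsets of A *)
Definition finite_subsets (U : Type) (A : set U) : set (set U) :=
  [set a | finite_set a /\ a `<=` A].

(* Carriers are subsets of an ambient type U, so that inclusion between
   carriers makes sense. The partial function j : A^* x A -> A is encoded with
   values in option U, where None means "undefined"; it is None outside of
   A^* x A, so a pair carries no information beyond (A, j). *)
Record partial_pair (U : Type) := PartialPair {
  carrier :> set U;
  pair_fun : set U * U -> option U;
  carrier_neq0 : carrier !=set0;
  pair_fun_dom : forall a alpha beta, pair_fun (a, alpha) = Some beta ->
    [/\ finite_subsets carrier a, carrier alpha & carrier beta];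
  pair_fun_inj : forall x y beta,
    pair_fun x = Some beta -> pair_fun y = Some beta -> x = y
}.

Definition dom (U : Type) (p : partial_pair U) : set (set U * U) :=
  [set x | pair_fun p x <> None].

Definition subpair (U : Type) (p q : partial_pair U) : Prop :=
  p `<=` q /\ forall x, dom p x -> pair_fun q x = pair_fun p x.

Record total_pair (U : Type) := TotalPair {
  pair_of_total :> partial_pair U;
  carrier_infinite : infinite_set pair_of_total;
  pair_fun_total : finite_subsets pair_of_total `*` pair_of_total
                     `<=` dom pair_of_total
}.

(* Not quotiented by alpha-conversion, under which interp is invariant. *)
Inductive term :=
  | Var of nat
  | App of term & term
  | Lam of nat & term.

Section GraphModel.
Variables (U : Type) (G : total_pair U).

(* rho : Var -> P(G) *)
Definition valuation (rho : nat -> set U) : Prop := forall x, rho x `<=` G.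

Definition update (rho : nat -> set U) (x : nat) (a : set U) : nat -> set U :=
  fun y => if y == x then a else rho y.

(* For total G, "i(a, alpha) \in X" is "i(a, alpha) = Some beta with beta \in X". *)
Fixpoint interp (M : term) (rho : nat -> set U) : set U :=
  match M with
  | Var x => rho x
  | App M N =>
      [set alpha | carrier G alpha /\ exists a, [/\ finite_set a, a `<=` interp N rho &
         exists2 beta, pair_fun G (a, alpha) = Some beta & interp M rho beta]]
  | Lam x M =>
      [set beta | exists a alpha, [/\ finite_subsets G a,
         interp M (update rho x a) alpha & pair_fun G (a, alpha) = Some beta]]
  end.

Definition Th_le : set (term * term) :=
  [set MN | forall rho, valuation rho ->
     interp MN.1 rho `<=` interp MN.2 rho].

Definition Th_eq : set (term * term) :=
  [set MN | forall rho, valuation rho ->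
     interp MN.1 rho = interp MN.2 rho].

End GraphModel.

(* Main.v *)
Require Import Defs.
From mathcomp Require Import all_boot.
From mathcomp Require Import boolp classical_sets functions cardinality.

Set Implicit Arguments.
Unset Strict Implicit.
Unset Printing Implicit Defensive.

Local Open Scope classical_set_scope.

(** This is a downward Loewenheim-Skolem theorem: the countable web [X] is a
    Skolem hull inside [G].

    Interpretations are continuous ([interp_continuous]): a point of [|M|_rho]
    already lies in [|M|_rho0] for some finite [rho0] below [rho].  Hence only
    valuations coded by a finite set of pairs (variable, point) matter, and
    over a countable set of points there are countably many of them.

    Suppose [X] is an infinite subset of [G] closed under [i], under passing
    from [i(a, u)] to [u] and the points of [a], and under application
    witnesses: whenever [u] in [X] belongs to [|MN|] at a finite valuation with
    values in [X], some finite [a] testifying to it is contained in [X].  Then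
    [X] with the restriction of [i] is a total pair, and by induction on [M]
    its interpretation is the trace on [X] of that of [G], for all valuations
    in [X] ([interp_restrict]).  Applications use closure under [i] and under
    witnesses; abstractions use closure under decomposition.

    Taking traces preserves inclusions, so the order theory can only grow.  It
    does not grow if [X] also contains, for each of the countably many pairs
    (M, N) outside [Th_le G], the finitely many points of a finite valuation
    and of a point separating M from N ([Th_le_separated]).  All these closure
    conditions are countably many finitary operations with countable values,
    so [countable_closure] provides a countable [X].  Equational theories
    follow, because the order theory determines them ([Th_eq_le]). *)

(** * Countability of terms *)

Fixpoint tree_of_term (M : term) : GenTree.tree nat :=
  match M with
  | Var x => GenTree.Leaf x
  | App M N => GenTree.Node 0 [:: tree_of_term M; tree_of_term N]
  | Lam x M => GenTree.Node 1 [:: GenTree.Leaf x; tree_of_term M]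
  end.

Fixpoint term_of_tree (t : GenTree.tree nat) : option term :=
  match t with
  | GenTree.Leaf x => Some (Var x)
  | GenTree.Node 0 [:: t; u] =>
      obind (fun M => omap (App M) (term_of_tree u)) (term_of_tree t)
  | GenTree.Node 1 [:: GenTree.Leaf x; t] => omap (Lam x) (term_of_tree t)
  | _ => None
  end.

Lemma tree_of_termK : pcancel tree_of_term term_of_tree.
Proof. by elim=> [x|M IHM N IHN|x M IHM] //=; rewrite ?IHM //= IHN. Qed.

Lemma countable_terms : countable [set: term].
Proof.
apply/countable_injP; exists (pickle \o tree_of_term) => M N _ _.
by move=> /(pcan_inj pickleK) /(pcan_inj tree_of_termK).
Qed.

(** * Countable closures under finitary operations *)

(** The compactness step of closure arguments: finitely many facts, each
    reached at some stage of an increasing chain, are all reached at the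
    largest of these stages. *)
Lemma finite_sub_bigcup (T V : Type) (A : set T) (F : T -> nat -> set V)
    (g : T -> V) : finite_set A ->
  (forall t, {homo F t : m n / (m <= n)%N >-> m `<=` n}) ->
  (forall t, A t -> exists n, F t n (g t)) ->
  exists n, forall t, A t -> F t n (g t).
Proof.
move=> finA homoF AF.
have /choice[f fP] t : exists n, A t -> F t n (g t).
  by have [/AF[n Fn]|nAt] := EM (A t); [exists n | exists 0].
have /finite_seqP[s fAE] := finite_image f finA.
exists (\max_(i <- s) i)%N => t At; apply: homoF (fP t At).
have : f t \in s by have : (f @` A) (f t) by [exists t]; rewrite fAE.
by move=> fts; exact: (@leq_bigmax_seq _ s xpredT id).
Qed.

Lemma countableU (T : Type) (A B : set T) :
  countable A -> countable B -> countable (A `|` B).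
Proof.
move=> cA cB; rewrite -bigcup2E; apply: bigcup_countable => // -[|[|n]] _ //=.
Qed.

(** The arguments of [op] are a finite set of points carrying tags from [K]
    together with one distinguished point.  With [K] the type of variables, such
    a tagged set is exactly a finite valuation; a set of points is one whose
    tags are all equal. *)
Lemma countable_closure (K : countType) (T : Type) (D S : set T)
    (op : set (K * T) -> T -> set T) :
    countable S -> S `<=` D ->
    (forall P t, countable (op P t)) -> (forall P t, op P t `<=` D) ->
  exists X : set T, [/\ countable X, S `<=` X, X `<=` D &
    forall P t, finite_set P -> P `<=` setT `*` X -> X t -> op P t `<=` X].
Proof.
move=> cS SD cop opD.
pose args X := [set P : set (K * T) | P `<=` setT `*` X /\ finite_set P] `*` X.
pose step X := X `|` \bigcup_(q in args X) op q.1 q.2.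
pose X n := iter n step S.
have homoX : {homo X : m n / (m <= n)%N >-> m `<=` n}.
  apply: homo_leq => [A //|A B C /subset_trans|n]; first exact.
  exact: subsetUl.
exists (\bigcup_n X n); split.
- apply: bigcup_countable => // n _; elim: n => [//|n IHn] /=.
  apply/countableU => //; apply: bigcup_countable => [|q _]; last exact: cop.
  by apply: countableX => //; apply/countable_finite_subset/countableX.
- by move=> t St; exists 0.
- move=> t [n _]; elim: n t => [|n IHn] t /=; first exact: SD.
  by case=> [/IHn //|[q _]]; exact: opD.
- move=> P t finP PX [m _ Xmt] u opu.
  have [|p /PX[_ [n _ Xn]]|n Pn] :=
    @finite_sub_bigcup _ _ P (fun=> X) snd finP.
  + by move=> _; exact: homoX.
  + by exists n.
  + exists (maxn m n).+1 => //=; right; exists (P, t) => //=; split=> /=.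
      split=> // p /Pn Xn; split=> //; apply: homoX Xn; exact: leq_maxr.
    by apply: homoX Xmt; exact: leq_maxl.
Qed.

Lemma infinite_countable_subset (T : Type) (A : set T) : infinite_set A ->
  exists B, [/\ countable B, infinite_set B & B `<=` A].
Proof.
move=> /infiniteP /card_leP [f].
have injf : {in [set: set_type [set: nat]] &, injective (val \o f)}.
  by move=> x y _ _ /val_inj /inj; apply; rewrite inE.
have eqB := inj_card_eq injf.
exists ((val \o f) @` setT); split=> [||_ [n _ <-]]; last exact: set_valP.
- by rewrite (eq_countable eqB); apply/countableP.
- by rewrite (eq_finite_set eqB) (eq_finite_set (card_setT _)); exact: infinite_nat.
Qed.

(** * Interpretations depend on finitely much of the valuation *)

(** A valuation is encoded by its graph, so that finitely supported valuations
    with finite values are finite sets. *)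
Definition val_of {U : Type} (P : set (nat * U)) : nat -> set U :=
  fun x => [set u | P (x, u)].

Section Continuity.
Variables (U : Type) (G : total_pair U).
Implicit Types (M N : term) (rho : nat -> set U).

Lemma update_mono rho rho' x (a : set U) : (forall y, rho y `<=` rho' y) ->
  forall y, update rho x a y `<=` update rho' x a y.
Proof. by move=> le y; rewrite /update; case: (y == x) => //; exact: le. Qed.

Lemma update_valuation (X : set U) rho x a : (forall y, rho y `<=` X) -> a `<=` X ->
  forall y, update rho x a y `<=` X.
Proof. by move=> rhoX aX y; rewrite /update; case: (y == x) => //; exact: rhoX. Qed.

Lemma interp_mono M rho rho' : (forall x, rho x `<=` rho' x) ->
  interp G M rho `<=` interp G M rho'.
Proof.
elim: M rho rho' => [x|M IHM N IHN|x M IHM] rho rho' le /=; first exact: le.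
- move=> u [Gu [a [fina aN [b ib Mb]]]]; split=> //; exists a; split=> //.
    by apply: subset_trans aN _; exact: IHN.
  by exists b => //; exact: IHM Mb.
- move=> b [a [u [fina Mu ib]]]; exists a, u; split=> //.
  by apply: IHM Mu; exact: update_mono.
Qed.

Lemma interp_sub M rho : valuation G rho -> interp G M rho `<=` G.
Proof.
elim: M rho => [x|M _ N _|x M _] rho Grho /=; first exact: Grho.
- by move=> u [].
- by move=> b [a [u [_ _ iu]]]; case: (pair_fun_dom iu).
Qed.

(** Each application or abstraction step uses only a finite part of the
    environment: an application looks at finitely many points of the argument,
    and below an abstraction the entries for the bound variable can be dropped
    since that variable is reset anyway. *)
Lemma interp_continuous M rho u : interp G M rho u ->
  exists P, [/\ finite_set P, forall x, val_of P x `<=` rho x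
              & interp G M (val_of P) u].
Proof.
elim: M rho u => [x|M IHM N IHN|x M IHM] rho u /=.
- move=> rhou; exists [set (x, u)]; split=> // y v /= [-> ->] //.
- move=> [Gu [a [fina aN [b ib /IHM[P [finP Prho MP]]]]]].
  have /choice[Q QP] v : exists Q, a v -> [/\ finite_set Q,
      forall x, val_of Q x `<=` rho x & interp G N (val_of Q) v].
    by have [/aN/IHN[Q ?]|nav] := EM (a v); [exists Q | exists set0].
  exists (P `|` \bigcup_(v in a) Q v); split.
  + rewrite finite_setU; split=> //; apply: bigcup_finite => // v /QP[] //.
  + by move=> x v [/Prho //|[w /QP[_ Qrho _] /Qrho]].
  + split=> //; exists a; split=> //.
      move=> v av; have [_ _ NQ] := QP v av; apply: interp_mono NQ.
      by move=> x w Qw; right; exists v.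
    by exists b => //; apply: interp_mono MP => x w Pw; left.
- move=> [a [v [fina /IHM[P [finP Prho MP]] iu]]].
  exists (P `&` [set p | p.1 != x]); split.
  + exact: finite_setIl.
  + by move=> y w [/Prho]; rewrite /update /= => + /negPf yx; rewrite yx.
  + exists a, v; split=> //; apply: interp_mono MP => y w Pw.
    have := Prho _ _ Pw; rewrite /update; case: eqP => //= /eqP yx _.
    by split.
Qed.

End Continuity.

(** * Finite certificates in the web *)

Definition separated (U : Type) (G : total_pair U) (X : set U) M N : Prop :=
  exists P, P `<=` setT `*` X /\ exists2 u, X u &
    interp G M (val_of P) u /\ ~ interp G N (val_of P) u.

(** By continuity, the valuation refuting an inclusion can be taken finite, and
    monotonicity keeps the point outside the right-hand side. *)
Lemma Th_le_separated (U : Type) (G : total_pair U) M N : ~ Th_le G (M, N) ->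
  exists Z, [/\ finite_set Z, Z `<=` G & separated G Z M N].
Proof.
move=> nle; apply: contrapT => nZ; apply: nle => rho Grho u Mu /=.
apply: contrapT => nNu; apply: nZ.
have [P [finP Prho MP]] := interp_continuous Mu.
exists (snd @` P `|` [set u]); split.
- by rewrite finite_setU; split=> //; exact: finite_image.
- by move=> v [[[x w] /Prho Pw <-]|->]; [exact: Grho Pw|exact: interp_sub Mu].
- exists P; split; first by move=> p Pp; split=> //=; left; exists p.
  by exists u; [right|split=> // /(interp_mono Prho)].
Qed.

Lemma finite_pair_fun_image (U : Type) (G : partial_pair U) p :
  finite_set [set b | pair_fun G p = Some b].
Proof.
case: (pair_fun G p) => [b|].
  by apply: sub_finite_set (finite_set1 b) => c [->].
by apply: sub_finite_set (finite_set0 U) => c.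
Qed.

Definition pair_parts (U : Type) (G : partial_pair U) (t : U) : set U :=
  [set v | exists a u, pair_fun G (a, u) = Some t /\ (a v \/ v = u)].

(** Injectivity gives [t] at most one decomposition, and that one is finite. *)
Lemma finite_pair_parts (U : Type) (G : partial_pair U) t :
  finite_set (pair_parts G t).
Proof.
have [[a [u iu]]|nt] := EM (exists a u, pair_fun G (a, u) = Some t).
  have [[fina _] _ _] := pair_fun_dom iu.
  apply: (@sub_finite_set _ _ (a `|` [set u])).
    move=> v [c [w [iw]]]; have [-> ->] := pair_fun_inj iw iu.
    by case; [left|right].
  by rewrite finite_setU; split.
apply: sub_finite_set (finite_set0 U) => v [a [u [iu _]]].
by apply: nt; exists a, u.
Qed.

(** * Restriction of a total pair to a closed subset *)

Section Restriction.
Variables (U : Type) (G : total_pair U) (X : set U).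
Hypothesis XG : X `<=` G.
Hypothesis infX : infinite_set X.
Hypothesis closedX : forall a u b, finite_subsets X a -> X u ->
  pair_fun G (a, u) = Some b -> X b.

Definition restrict_fun (p : set U * U) : option U :=
  if `[< finite_subsets X p.1 /\ X p.2 >] then pair_fun G p else None.

Lemma restrict_funP a u b : restrict_fun (a, u) = Some b <->
  [/\ finite_subsets X a, X u & pair_fun G (a, u) = Some b].
Proof.
rewrite /restrict_fun; case: asboolP => /= [[Xa Xu]|nX]; split=> // -[] //.
by move=> Xa Xu; case: nX.
Qed.

Lemma restrict_fun_dom a u b : restrict_fun (a, u) = Some b ->
  [/\ finite_subsets X a, X u & X b].
Proof. by move=> /restrict_funP[Xa Xu ib]; split=> //; exact: closedX ib. Qed.

Lemma restrict_fun_inj p q b :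
  restrict_fun p = Some b -> restrict_fun q = Some b -> p = q.
Proof.
case: p q => [a u] [c v] /restrict_funP[_ _ ia] /restrict_funP[_ _ ic].
exact: pair_fun_inj ia ic.
Qed.

Definition restrict_pair : partial_pair U :=
  PartialPair (infinite_setN0 infX) restrict_fun_dom restrict_fun_inj.

Lemma restrict_fun_total :
  finite_subsets restrict_pair `*` restrict_pair `<=` dom restrict_pair.
Proof.
move=> [a u] [/= Xa Xu]; rewrite /dom /= /restrict_fun.
case: asboolP => [_|nX]; last by case: nX.
apply: pair_fun_total; split; last exact: XG.
by case: Xa => fina aX; split=> //; exact: subset_trans aX XG.
Qed.

Definition restrict : total_pair U :=
  @TotalPair U restrict_pair infX restrict_fun_total.

Lemma restrict_subpair : subpair restrict G.
Proof.
split=> [|[a u]]; first exact: XG.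
by rewrite /dom /= /restrict_fun; case: asboolP.
Qed.

Hypothesis splitX : forall a u b, pair_fun G (a, u) = Some b -> X b ->
  a `<=` X /\ X u.
Hypothesis witX : forall M N P u, finite_set P -> P `<=` setT `*` X -> X u ->
  interp G (App M N) (val_of P) u ->
  exists a, [/\ finite_set a, a `<=` X, a `<=` interp G N (val_of P)
    & exists2 b, pair_fun G (a, u) = Some b & interp G M (val_of P) b].

(** The trace property.  In the application case, continuity first shrinks the
    valuation to a finite one, the only kind for which witnesses are in [X]. *)
Lemma interp_restrict M rho : valuation restrict rho ->
  interp restrict M rho = interp G M rho `&` X.
Proof.
elim: M rho => [x|M IHM N IHN|x M IHM] rho Xrho; apply/seteqP; split=> u /=.
- by move=> rhou; split=> //; exact: Xrho rhou.
- by case.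
- move=> [Xu [a [fina aN [b /restrict_funP[_ _ ib]]]]]; rewrite IHM// => -[Mb _].
  split=> //; split; first exact: XG.
  exists a; split=> //; last by exists b.
  by move=> v /aN; rewrite IHN// => -[].
- move=> [MNu Xu].
  have [P [finP Prho MNP]] := @interp_continuous _ G (App M N) rho u MNu.
  have PX : P `<=` setT `*` X by move=> [x v] /Prho /= /Xrho.
  have [a [fina aX aN [b ib Mb]]] := witX finP PX Xu MNP.
  split=> //; exists a; split=> //.
    move=> v av; rewrite IHN//; split; last exact: aX.
    by apply: interp_mono (aN v av); exact: Prho.
  exists b; first exact/restrict_funP.
  rewrite IHM//; split; first exact: interp_mono Mb.
  by apply: closedX ib.
- move=> [a [v [[fina aX] Mv /restrict_funP[_ Xv iu]]]].
  split; last exact: closedX iu.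
  exists a, v; split=> //; first by split=> //; exact: subset_trans aX XG.
  by move: Mv; rewrite IHM; [case|exact: update_valuation].
- move=> [[a [v [[fina aG] Mv iu]]] Xu]; have [aX Xv] := splitX iu Xu.
  exists a, v; split=> //; last exact/restrict_funP.
  by rewrite IHM//; exact: update_valuation.
Qed.

Hypothesis sepX : forall M N, ~ Th_le G (M, N) -> separated G X M N.

Lemma Th_le_restrict : Th_le restrict = Th_le G.
Proof.
apply/seteqP; split=> -[M N] /= le.
- apply: contrapT => /sepX[P [PX [u Xu [Mu nNu]]]].
  have valP : valuation restrict (val_of P) by move=> x v /PX[].
  by have := le _ valP u; rewrite /= !interp_restrict// => -[].
- move=> rho Xrho /=; rewrite !interp_restrict//; apply: setSI.
  by apply: le => x v /Xrho /XG.
Qed.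

End Restriction.

Lemma Th_eq_le U (G : total_pair U) :
  Th_eq G = Th_le G `&` [set MN | Th_le G (MN.2, MN.1)].
Proof.
apply/seteqP; split=> -[M N] /=.
- by move=> e; split=> rho /e /= ->.
- by move=> [le ge] rho Grho; apply/seteqP; split; [exact: le|exact: ge].
Qed.

Theorem theorem9p2 (U : Type) (G : total_pair U) :
  exists G' : total_pair U,
    [/\ countable G', subpair G' G, Th_le G' = Th_le G & Th_eq G' = Th_eq G].
Proof.
(* A countable infinite part of G makes the hull infinite. *)
have [B [cB infB BG]] := infinite_countable_subset (@carrier_infinite _ G).
have /choice[sep sepP] (MN : term * term) : exists Z, [/\ finite_set Z, Z `<=` G &
    ~ Th_le G MN -> separated G Z MN.1 MN.2].
  have [le|/Th_le_separated[Z [finZ ZG sepZ]]] := EM (Th_le G (MN.1, MN.2)).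
    by exists set0; split=> //; case: MN le.
  by exists Z.
have /choice[wit witP] (q : (term * term) * (set (nat * U) * U)) : exists a,
    finite_set a /\ (interp G (App q.1.1 q.1.2) (val_of q.2.1) q.2.2 ->
      a `<=` interp G q.1.2 (val_of q.2.1) /\
      exists2 b, pair_fun G (a, q.2.2) = Some b &
                 interp G q.1.1 (val_of q.2.1) b).
  have [/= [_ [a [fina aN ?]]]|nMN] :=
    EM (interp G (App q.1.1 q.1.2) (val_of q.2.1) q.2.2); first by exists a.
  by exists set0.
have cTT : countable [set: term * term].
  by rewrite -setXTT; apply: countableX; exact: countable_terms.
(* The points of P tagged 0 form the finite set to which i is applied; read as
   a valuation, P is an argument of the application witnesses. *)
pose op (P : set (nat * U)) (t : U) : set U :=
  ([set b | pair_fun G (val_of P 0, t) = Some b]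
   `|` pair_parts G t
   `|` \bigcup_MN wit (MN, (P, t))) `&` G.
have cS : countable (B `|` \bigcup_MN sep MN).
  apply: countableU => //; apply: bigcup_countable => // MN _.
  by have [/finite_set_countable] := sepP MN.
have SG : B `|` \bigcup_MN sep MN `<=` G.
  by move=> u [/BG //|[MN _]]; have [_ + _] := sepP MN; exact.
have cop P t : countable (op P t).
  apply: (@sub_countable _ _ _ _ (subset_card_le (@subIsetl _ _ _))).
  apply: countableU; first apply: countableU.
  - exact/finite_set_countable/finite_pair_fun_image.
  - exact/finite_set_countable/finite_pair_parts.
  - apply: bigcup_countable => // MN _.
    by have [/finite_set_countable] := witP (MN, (P, t)).
have [X [cX SX XG opX]] := countable_closure cS SG cop (fun P t => @subIsetr _ _ _).
have infX : infinite_set X.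
  by apply: sub_infinite_set infB => u Bu; apply: SX; left.
have closedX a u b : finite_subsets X a -> X u ->
    pair_fun G (a, u) = Some b -> X b.
  move=> [fina aX] Xu ib; apply: (opX ([set 0] `*` a) u) => //.
  - exact: finite_setX.
  - by move=> p [_ /aX].
  - split; last by case: (pair_fun_dom ib).
    left; left => /=; rewrite -ib; congr (pair_fun G (_, _)).
    by apply/seteqP; split=> v /=; [case|split].
have splitX a u b : pair_fun G (a, u) = Some b -> X b -> a `<=` X /\ X u.
  move=> ib Xb; have [[fina aG] Gu _] := pair_fun_dom ib.
  have opXb : op set0 b `<=` X by apply: opX.
  split=> [v av|]; apply: opXb; split=> //; try exact: aG.
    by left; right; exists a, u; split=> //; left.
  by left; right; exists a, u; split=> //; right.
have witX M N P u : finite_set P -> P `<=` setT `*` X -> X u ->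
    interp G (App M N) (val_of P) u ->
    exists a, [/\ finite_set a, a `<=` X, a `<=` interp G N (val_of P)
      & exists2 b, pair_fun G (a, u) = Some b & interp G M (val_of P) b].
  move=> finP PX Xu MNu; have [fina /(_ MNu)[aN ib]] := witP ((M, N), (P, u)).
  exists (wit ((M, N), (P, u))); split=> // v av.
  apply: (opX P u) => //; split; first by right; exists (M, N).
  by apply: interp_sub (aN v av) => x w /PX[_ /XG].
have sepX M N : ~ Th_le G (M, N) -> separated G X M N.
  move=> nle; have [_ _ /(_ nle)[P [PZ [u Zu MNu]]]] := sepP (M, N).
  have ZX : sep (M, N) `<=` X by move=> v Zv; apply: SX; right; exists (M, N).
  exists P; split; first by move=> p /PZ[_ /ZX].
  by exists u => //; exact: ZX.
have le := Th_le_restrict XG infX closedX splitX witX sepX.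
exists (restrict XG infX closedX); split=> //; first exact: restrict_subpair.
by rewrite !Th_eq_le le.
Qed.
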